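(* Let $n\ge2$, $\alpha>0$, and let $$\mathfrak{L}u=x_n^{2\alpha}\Delta_{x'}u+\partial^2_{x_nx_n}u .$$ Let $u\in C^1(\mathbb{R}^n_+)\cap C(\overline{\mathbb{R}^n_+})$ be a viscosity solution of $\mathfrak{L}u=0$ in $\mathbb{R}^n_+$ with $u=0$ on $\{x_n=0\}$. If $|Du(x)|\to0$ as $|x|\to\infty$, then $u\equiv0$.
   Context: Points of $\mathbb{R}^n$ are written $x=(x',x_n)$ with $x'=(x_1,\dots,x_{n-1})\in\mathbb{R}^{n-1}$; $\mathbb{R}^n_+=\{x_n>0\}$; $\Delta_{x'}=\sum_{i=1}^{n-1}\partial^2_{x_ix_i}$. Solutions are understood in the standard ($C$-)viscosity sense. *)

(* Defs.v *)
From HB Require Import structures.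
From mathcomp Require Import all_boot all_order all_algebra.
From mathcomp Require Import all_classical all_reals all_analysis.

Set Implicit Arguments.
Unset Strict Implicit.
Unset Printing Implicit Defensive.

Import Order.TTheory GRing.Theory Num.Theory.
Import numFieldNormedType.Exports.

Local Open Scope classical_set_scope.
Local Open Scope ring_scope.

(* Points of the (m+1)-dimensional space are row vectors 'rV[R]_m.+1; the last
   coordinate x_n is x 0 ord_max and x' consists of the coordinates
   i != ord_max.  Functions on a subset Omega are total functions of which only
   the values on Omega matter. *)

Section Euclidean.
Variables (R : realType) (m : nat).
Local Notation E := 'rV[R]_m.+1.

(* The library's `|x| on row vectors is the sup norm. *)
Definition enorm (x : E) : R := Num.sqrt (\sum_i x 0 i ^+ 2).

Definition partial (i : 'I_m.+1) (f : E -> R) : E -> R :=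
  fun x => 'D_(delta_mx 0 i) f x.

Definition grad (f : E -> R) (x : E) : E := \row_i partial i f x.

(* f is of class C^k on Omega (meant for Omega open): the iterated partial
   derivatives of f up to order k exist and are continuous on Omega. *)
Fixpoint classC (k : nat) (Omega : set E) (f : E -> R) : Prop :=
  {in Omega, continuous f} /\
  match k with
  | 0 => True
  | k'.+1 => forall i : 'I_m.+1,
      (forall x, Omega x -> derivable f x (delta_mx 0 i)) /\
      classC k' Omega (partial i f)
  end.

(* Continuous viscosity sub- and supersolutions of L u = 0 in the open set
   Omega, for a second-order operator L acting on C^2 functions. *)
Definition viscosity_subsolution (L : (E -> R) -> E -> R) (Omega : set E)
    (u : E -> R) : Prop :=
  {in Omega, continuous u} /\
  forall (phi : E -> R) (x0 : E), classC 2 Omega phi -> Omega x0 ->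
    (\forall x \near x0, u x - phi x <= u x0 - phi x0) ->
    0 <= L phi x0.

Definition viscosity_supersolution (L : (E -> R) -> E -> R) (Omega : set E)
    (u : E -> R) : Prop :=
  {in Omega, continuous u} /\
  forall (phi : E -> R) (x0 : E), classC 2 Omega phi -> Omega x0 ->
    (\forall x \near x0, u x0 - phi x0 <= u x - phi x) ->
    L phi x0 <= 0.

Definition viscosity_solution (L : (E -> R) -> E -> R) (Omega : set E)
    (u : E -> R) : Prop :=
  viscosity_subsolution L Omega u /\ viscosity_supersolution L Omega u.

Definition halfspace : set E := [set x | 0 < x 0 ord_max].

Definition laplacian' (f : E -> R) (x : E) : R :=
  \sum_(i < m.+1 | i != ord_max) partial i (partial i f) x.

Definition grushin (alpha : R) (f : E -> R) (x : E) : R :=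
  (x 0 ord_max) `^ (2 * alpha) * laplacian' f x
  + partial ord_max (partial ord_max f) x.

End Euclidean.

Arguments halfspace {R m}.

(* Main.v *)
(** Vertical integration from [x_n = 0] makes [u - eps x_n] nonpositive outside a
    compact box: laterally because [|Du|] is small there, and at large height
    because [|u| <= C + (eps / 2) x_n].  A positive maximum inside the box would
    persist for [u - eps x_n + d x_n^2] with small [d > 0], so [u] would be touched
    from above by [eps x_n - d x_n^2], on which the operator equals [- 2 d < 0].
    Letting [eps] tend to 0 gives [u <= 0]; the same argument applies to [- u]. *)

Require Import Defs.
From mathcomp Require Import all_boot all_order all_algebra.
From mathcomp Require Import all_classical all_reals all_analysis.
From mathcomp Require Import ring lra.
Import Order.TTheory GRing.Theory Num.Theory.
Import numFieldNormedType.Exports.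
Local Open Scope classical_set_scope.
Local Open Scope ring_scope.

Set Implicit Arguments.
Unset Strict Implicit.
Unset Printing Implicit Defensive.

(** * Test functions quadratic in the vertical variable *)

Definition vquad (R : realType) (m : nat) (a b c : R) (x : 'rV[R]_m.+1) : R :=
  a * x 0 ord_max ^+ 2 + b * x 0 ord_max + c.

Lemma continuous_vquad (R : realType) (m : nat) (a b c : R) :
  continuous (@vquad R m a b c).
Proof.
have -> : @vquad R m a b c =
    fun x => (a * x 0 ord_max + b) * x 0 ord_max + c.
  by apply/funext => x; rewrite /vquad; ring.
move=> x; have cx := @coord_continuous R _ _ 0 (@ord_max m) x.
exact: (cvgD (cvgM (cvgD (cvgM (cvg_cst a) cx) (cvg_cst b)) cx) (cvg_cst c)).
Qed.

Lemma is_derive_coord (R : realType) (m : nat) (i j : 'I_m.+1) (x : 'rV[R]_m.+1) :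
  is_derive x (delta_mx 0 i) (fun y : 'rV[R]_m.+1 => y 0 j) (i == j)%:R.
Proof.
have E : (fun h : R => h^-1 *: (((fun y : 'rV[R]_m.+1 => y 0 j) \o shift x)
    (h *: delta_mx 0 i) - x 0 j)) @ 0^' --> ((i == j)%:R : R).
  apply: cvg_near_cst; near=> h; rewrite /= !mxE addrK eqxx /= eq_sym.
  rewrite -[_ *: _]/(_ * _) mulKf//.
  by near: h; exact: nbhs_dnbhs_neq.
by split; [apply/cvg_ex; exists (i == j)%:R | apply: cvg_lim].
Unshelve. all: by end_near. Qed.

Lemma is_derive_vquad (R : realType) (m : nat) (a b c : R) (i : 'I_m.+1) x :
  is_derive x (delta_mx 0 i) (vquad a b c)
    (vquad 0 (2 * a * (i == ord_max)%:R) (b * (i == ord_max)%:R) x).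
Proof.
(* The derivative rules give both the function and its derivative in another shape; [ext] transports
   the result along the two equalities. *)
have ext (f : 'rV[R]_m.+1 -> R) df : is_derive x (delta_mx 0 i) f df ->
    f =1 vquad a b c -> df = vquad 0 (2 * a * (i == ord_max)%:R)
      (b * (i == ord_max)%:R) x ->
    is_derive x (delta_mx 0 i) (vquad a b c)
      (vquad 0 (2 * a * (i == ord_max)%:R) (b * (i == ord_max)%:R) x).
  by move=> + /funext <- <-.
have dx := is_derive_coord i ord_max x.
apply: ext (is_deriveD (is_deriveD (is_deriveZ a (is_deriveX 2 dx))
  (is_deriveZ b dx)) (is_derive_cst c x _)) _ _.
  by move=> y; rewrite /vquad !fctE.
rewrite /vquad; move: (_%:R) => k; rewrite -![_ *: _]/(_ * _) /=; ring.
Qed.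
Lemma partial_vquad (R : realType) (m : nat) (a b c : R) (i : 'I_m.+1) :
  partial i (vquad a b c) =
    vquad 0 (2 * a * (i == ord_max)%:R) (b * (i == ord_max)%:R).
Proof. by apply/funext => x; have [_ <-] := is_derive_vquad a b c i x. Qed.

(** Each partial derivative of a [vquad] is again a [vquad], so induction on [k] closes once the
    coefficients are generalized. *)
Lemma classC_vquad (R : realType) (m : nat) (k : nat) (Omega : set 'rV[R]_m.+1)
  (a b c : R) : classC k Omega (@vquad R m a b c).
Proof.
elim: k a b c => [|k IH] a b c; (split; first by move=> x _; exact: continuous_vquad).
  by [].
by move=> i; split=> [x _|]; [have [] := is_derive_vquad a b c i x | rewrite partial_vquad].
Qed.

(** Horizontal derivatives vanish, so the degenerate weight multiplies zero and only the vertical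
    second derivative survives. *)
Lemma grushin_vquad (R : realType) (m : nat) (alpha a b c : R) x :
  grushin alpha (@vquad R m a b c) x = 2 * a.
Proof.
rewrite /grushin /laplacian' big1 => [|i /negPf ni].
  by rewrite !partial_vquad /vquad eqxx /=; ring.
by rewrite !partial_vquad /vquad ni /=; ring.
Qed.

(** * Vertical translations and the closed half-space *)

Definition vshift (R : realType) (m : nat) (x : 'rV[R]_m.+1) (t : R) :=
  x + t *: delta_mx 0 ord_max.

Lemma vshift0 (R : realType) (m : nat) (x : 'rV[R]_m.+1) : vshift x 0 = x.
Proof. by rewrite /vshift scale0r addr0. Qed.

Lemma vshift_max (R : realType) (m : nat) (x : 'rV[R]_m.+1) t :
  vshift x t 0 ord_max = x 0 ord_max + t.
Proof. by rewrite !mxE !eqxx mulr1. Qed.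

Lemma vshift_neq (R : realType) (m : nat) (x : 'rV[R]_m.+1) t i :
  i != ord_max -> vshift x t 0 i = x 0 i.
Proof. by move=> /negPf ni; rewrite !mxE ni andbF mulr0 addr0. Qed.

Lemma vshiftK (R : realType) (m : nat) (x : 'rV[R]_m.+1) t :
  vshift (vshift x (- t)) t = x.
Proof. by rewrite /vshift scaleNr subrK. Qed.

Lemma continuous_vshift (R : realType) (m : nat) (x : 'rV[R]_m.+1) :
  continuous (vshift x).
Proof.
by move=> t; apply: cvgD; [exact: cvg_cst | apply: cvgZr_tmp].
Qed.

(** The difference quotient in [t] is exactly the directional difference quotient of [u] at the
    shifted point. *)
Lemma is_derive_vshift (R : realType) (m : nat) (u : 'rV[R]_m.+1 -> R) x t :
  derivable u (vshift x t) (delta_mx 0 ord_max) ->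
  is_derive t 1 (fun s => u (vshift x s)) (partial ord_max u (vshift x t)).
Proof.
have E : (fun h : R => h^-1 *: (((fun s => u (vshift x s)) \o shift t) (h *: 1)
            - u (vshift x t))) =
         (fun h => h^-1 *: ((u \o shift (vshift x t)) (h *: delta_mx 0 ord_max)
            - u (vshift x t))).
  apply/funext => h /=; congr (_ *: (u _ - _)).
  by rewrite /vshift /= scalerDl addrCA [h *: 1]mulr1.
by move=> du; split; rewrite /derivable /partial /derive E.
Qed.

Lemma closure_halfspace (R : realType) (m : nat) :
  closure (@halfspace R m) = [set x | 0 <= x 0 ord_max].
Proof.
apply/seteqP; split=> x.
  have cl : closed [set x : 'rV[R]_m.+1 | 0 <= x 0 ord_max].
    apply: (@closed_comp _ _ (fun x : 'rV[R]_m.+1 => x 0 ord_max) [set t | 0 <= t]).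
      by move=> y _; exact: coord_continuous.
    exact: closed_ge.
  by move=> hx; apply: cl; apply: closure_subset hx => y /ltW.
move=> /= x0 B xB.
(* Moving up from [x] by a small [t > 0] enters the open half-space without leaving [B]. *)
have : \forall t \near (0 : R)^'+, B (vshift x t).
  apply: cvg_within; have := @continuous_vshift _ _ x 0 B.
  by rewrite vshift0; exact.
move=> Bt.
have hBt : \forall t \near (0 : R)^'+, halfspace (vshift x t) /\ B (vshift x t).
  near=> t; split; last by near: t.
  by rewrite /halfspace /= vshift_max ltr_wpDl//; near: t; exact: nbhs_right_gt.
have [t [ht Bvt]] := @filter_ex _ _ (at_right_proper_filter 0) _ hBt.
by exists (vshift x t).
Unshelve. all: by end_near. Qed.

(** * From gradient bounds to vertical increments *)

Lemma ler_enorm (R : realType) (m : nat) (x : 'rV[R]_m.+1) i :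
  `|x 0 i| <= enorm x.
Proof.
rewrite /enorm -sqrtr_sqr ler_wsqrtr// (bigD1 i)//= lerDl.
by apply: sumr_ge0 => j _; exact: sqr_ge0.
Qed.

(** Using increments instead of derivatives admits starting points on the boundary and is stable
    under [v] to [- v]. The existential places [x] outside the sup-norm ball of radius [M]. *)
Definition vlip (R : realType) (m : nat) (eps M : R) (v : 'rV[R]_m.+1 -> R) :=
  forall (x : 'rV[R]_m.+1) t, 0 <= x 0 ord_max -> 0 <= t -> (exists i, M < `|x 0 i|) ->
    `|v (vshift x t) - v x| <= eps * t.

(** Mean value theorem on a vertical segment. Going up fixes the horizontal coordinates and does not
    decrease the height, so some coordinate, hence [enorm], stays above [M] and the gradient bound
    applies. *)
Lemma vlip_grad (R : realType) (m : nat) (eps M : R) (u : 'rV[R]_m.+1 -> R) :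
  (forall x, halfspace x -> derivable u x (delta_mx 0 ord_max)) ->
  {within closure halfspace, continuous u} ->
  (forall x, halfspace x -> M < enorm x -> enorm (grad u x) < eps) ->
  vlip eps M u.
Proof.
rewrite closure_halfspace => du /subspace_continuousP cu gu x t x0 t0 [i xi].
have hp s : s \in `]0, t[ -> halfspace (vshift x s).
  by rewrite in_itv /halfspace /= vshift_max => /andP[s0 _]; rewrite ltr_wpDl.
have [->|t_neq0] := eqVneq t 0.
  by rewrite vshift0 subrr normr0 mulr0.
have {t_neq0} t_gt0 : 0 < t by rewrite lt_neqAle eq_sym t_neq0.
have dus s : s \in `]0, t[ ->
    is_derive s 1 (fun s => u (vshift x s)) (partial ord_max u (vshift x s)).
  by move=> /hp /du; exact: is_derive_vshift.
(* The lower end may lie on the boundary, so only continuity within the closed half-space is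
   available there. *)
have cus : {within `[0, t], continuous (fun s => u (vshift x s))}.
  apply/subspace_continuousP => s; rewrite /= in_itv /= => /andP[s0 _] W uW.
  have /cu /(_ W uW) : 0 <= vshift x s 0 ord_max by rewrite vshift_max addr_ge0.
  move=> /(@continuous_vshift _ _ x s _) Ws.
  have : \forall r \near s, `[0, t]%classic r -> W (u (vshift x r)).
    near=> r; rewrite /= in_itv /= => /andP[r0 _].
    have : 0 <= vshift x r 0 ord_max by rewrite vshift_max addr_ge0.
    by near: r.
  by [].
have [c ct] := MVT t_gt0 dus cus.
rewrite subr0 vshift0 => ->.
rewrite normrM (ger0_norm t0) ler_wpM2r//.
have : enorm (grad u (vshift x c)) < eps.
  apply: gu; first exact: hp.
  apply: (lt_le_trans xi); apply: le_trans (ler_enorm _ i).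
  have [->|ni] := eqVneq i ord_max; last by rewrite vshift_neq.
  move: ct; rewrite in_itv /= vshift_max => /andP[c0 _].
  by rewrite !ger0_norm ?addr_ge0 ?lerDl// ltW.
move=> /ltW; apply: le_trans; apply: le_trans (ler_enorm _ ord_max).
by rewrite mxE.
Unshelve. all: by end_near. Qed.

(** * Growth bound and maximum on a compact box *)

Definition vbox (R : realType) (m : nat) (A B : R) : set 'rV[R]_m.+1 :=
  [set x | (forall i, i != ord_max -> `|x 0 i| <= A) /\ 0 <= x 0 ord_max <= B].

Lemma compact_vbox (R : realType) (m : nat) (A B : R) : compact (@vbox R m A B).
Proof.
have -> : @vbox R m A B = [set x : 'rV[R]_m.+1 | forall i,
    (if i == ord_max then `[0, B]%classic else `[- A, A]%classic) (x ord0 i)].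
  apply/seteqP; split=> x /=.
    move=> [xA xB] i; case: eqVneq => [->|/xA]; first by rewrite /= in_itv.
    by rewrite /= in_itv /= ler_norml.
  move=> xAB; split=> [i /negPf ni|]; last first.
    by have := xAB ord_max; rewrite eqxx /= in_itv.
  by have := xAB i; rewrite ni /= in_itv /= ler_norml.
apply: (@rV_compact R m.+1
  (fun i => if i == ord_max then `[0, B]%classic else `[- A, A]%classic)) => i.
by case: ifP => _; exact: segment_compact.
Qed.

Lemma vbox_subset (R : realType) (m : nat) (A B : R) :
  @vbox R m A B `<=` closure halfspace.
Proof. by rewrite closure_halfspace => x [_ /andP[]]. Qed.

(** Two regimes. With a large horizontal coordinate, descend to the boundary, where [v] vanishes.
    Otherwise descend to the top face of a box, where [v] is bounded by compactness; slope [eps]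
    eventually absorbs that bound, since [v] climbs with slope at most [eps / 2]. *)
Lemma vlip_growth (R : realType) (m : nat) (eps M : R) (v : 'rV[R]_m.+1 -> R) :
  {within closure halfspace, continuous v} ->
  (forall (x : 'rV[R]_m.+1), x 0 ord_max = 0 -> v x = 0) ->
  0 < eps -> vlip (eps / 2) M v ->
  exists N, forall (x : 'rV[R]_m.+1), 0 <= x 0 ord_max ->
    (exists2 i, i != ord_max & M < `|x 0 i|) \/ N <= x 0 ord_max ->
    v x <= eps * x 0 ord_max.
Proof.
(* [H] exceeds [M], so every point at height [H] is an admissible start for [vlip]. *)
move=> cv bv eps0 lv; pose H := `|M| + 1.
have H0 : 0 <= H by rewrite addr_ge0.
have MH : M < H by rewrite ltr_pwDr// ler_norm.
have [c _ vc] : exists2 c, c \in vbox `|M| H & forall y, y \in vbox `|M| H -> v y <= v c.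
  apply: compact_EVT_max; [|exact: compact_vbox|].
    exists 0; split=> [i _|]; first by rewrite mxE normr0.
    by rewrite mxE lexx.
  by apply: continuous_subspaceW cv; exact: vbox_subset.
have side (x : 'rV[R]_m.+1) : 0 <= x 0 ord_max ->
    (exists2 i, i != ord_max & M < `|x 0 i|) -> v x <= eps * x 0 ord_max.
  move=> x0 [i ni xi].
  have yi : exists i, M < `|vshift x (- x 0 ord_max) 0 i|.
    by exists i; rewrite vshift_neq.
  have := lv (vshift x (- x 0 ord_max)) (x 0 ord_max).
  rewrite vshiftK vshift_max subrr lexx => /(_ isT x0 yi).
  rewrite (bv (vshift _ _)) ?vshift_max ?subrr//
    subr0 ler_norml => /andP[_ /le_trans]; apply.
  by rewrite ler_wpM2r// ler_pdivrMr// ler_peMr ?ltW// ltr1n.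
(* Above this height [|v c|] is at most [(eps / 2) (x_n - H)], the half of the slope left over by
   [vlip]. *)
exists (H + 2 * `|v c| / eps) => x x0 [|xN]; first exact: side.
have [|xM] := pselect (exists2 i, i != ord_max & M < `|x 0 i|); first exact: side.
have cN : 2 * `|v c| <= eps * (x 0 ord_max - H).
  by rewrite [leRHS]mulrC -ler_pdivrMr// lerBrDl.
have xH : 0 <= x 0 ord_max - H.
  by rewrite -(pmulr_rge0 _ eps0); apply: le_trans cN; rewrite mulr_ge0.
have yH : vshift x (- (x 0 ord_max - H)) 0 ord_max = H by rewrite vshift_max; ring.
have yM : exists i, M < `|vshift x (- (x 0 ord_max - H)) 0 i|.
  by exists ord_max; rewrite yH ger0_norm.
have := lv (vshift x (- (x 0 ord_max - H))) (x 0 ord_max - H).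
rewrite vshiftK yH => /(_ H0 xH yM).
have : v (vshift x (- (x 0 ord_max - H))) <= v c.
  apply: vc; rewrite inE; split; last by rewrite yH H0 lexx.
  move=> i ni; rewrite vshift_neq// (le_trans _ (ler_norm M))// leNgt.
  by apply/negP => Mx; apply: xM; exists i.
have := ler_norm (v c); have := mulr_ge0 (ltW eps0) H0.
move: cN; rewrite ler_norml => + + + + /andP[_]; lra.
Qed.

(** The hypothesis on [vquad] is the subsolution test with the operator already evaluated to
    [2 * a]; in this form it fits both [u] and [- u]. *)
Lemma vlip_barrier (R : realType) (m : nat) (eps M : R) (v : 'rV[R]_m.+1 -> R) :
  {within closure halfspace, continuous v} ->
  (forall (x : 'rV[R]_m.+1), x 0 ord_max = 0 -> v x = 0) ->
  0 < eps -> vlip (eps / 2) M v ->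
  (forall a b c x0, halfspace x0 ->
    (\forall x \near x0, v x - vquad a b c x <= v x0 - vquad a b c x0) ->
    0 <= 2 * a) ->
  forall (x : 'rV[R]_m.+1), 0 <= x 0 ord_max -> v x <= eps * x 0 ord_max.
Proof.
move=> cv bv eps0 lv tv; have [N vN] := vlip_growth cv bv eps0 lv.
move=> x1 x1_ge0; rewrite leNgt; apply/negP => vx1.
(* A point violating the bound satisfies all constraints of the box of half-width [M + 1] and height
   [N] strictly. *)
have inbox (x : 'rV[R]_m.+1) : 0 <= x 0 ord_max -> eps * x 0 ord_max < v x ->
    [/\ halfspace x, (forall i, i != ord_max -> `|x 0 i| < M + 1) & x 0 ord_max < N].
  move=> x0 vx; split.
  - rewrite /halfspace /= lt_neqAle x0 andbT eq_sym; apply/eqP => xe.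
    by move: vx; rewrite bv// xe mulr0 ltxx.
  - move=> i ni; rewrite (@le_lt_trans _ _ M) ?ltrDl// leNgt; apply/negP => Mx.
    by move: vx; rewrite ltNge vN//; left; exists i.
  - by rewrite ltNge; apply/negP => Nx; move: vx; rewrite ltNge vN//; right.
(* On the box the added term [d x_n^2] is at most [d N^2], less than the excess [d (N^2 + 1)] at
   [x1]; hence the maximizer of the perturbed function still violates the bound. *)
pose d := (v x1 - eps * x1 0 ord_max) / (N ^+ 2 + 1).
have N1 : 0 < N ^+ 2 + 1 by rewrite ltr_wpDl// sqr_ge0.
have dN : d * (N ^+ 2 + 1) = v x1 - eps * x1 0 ord_max by rewrite divfK// gt_eqF.
have d0 : 0 < d by rewrite divr_gt0// subr_gt0.
have cw : {within closure halfspace, continuous (fun x => v x - vquad (- d) eps 0 x)}.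
  by move=> x; apply: cvgB; [exact: cv | exact: (continuous_subspaceT (@continuous_vquad _ _ _ _ _))].
have boxx1 : vbox (M + 1) N x1.
  have [_ x1M x1N] := inbox _ x1_ge0 vx1.
  by split=> [i /x1M /ltW //|]; rewrite x1_ge0 ltW.
have [x0] := compact_EVT_max (ex_intro _ x1 boxx1) (@compact_vbox _ _ (M + 1) N)
  (continuous_subspaceW (@vbox_subset _ _ _ _) cw).
rewrite inE => -[_ /andP[x0_ge0 x0N]] max0.
have vx0 : eps * x0 0 ord_max < v x0.
  have := max0 x1 (mem_set boxx1); rewrite /vquad.
  have : x0 0 ord_max ^+ 2 <= N ^+ 2 by rewrite ler_sqr ?nnegrE// (le_trans x0_ge0).
  have := sqr_ge0 (x1 0 ord_max).
  move=> /(mulr_ge0 (ltW d0)) ? /(ler_wpM2l (ltW d0)) ?; lra.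
have [hx0 x0M {}x0N] := inbox _ x0_ge0 vx0.
(* By [inbox] the maximizer is interior to the box, so the maximum is a local one and the test
   applies with leading coefficient [- d]. *)
suff : 0 <= 2 * - d by lra.
apply: (tv (- d) eps 0 x0 hx0); near=> x.
apply: max0; rewrite inE; split; last first.
  apply/andP; split; apply: ltW; near: x.
    exact: (@coord_continuous R _ _ 0 (@ord_max m) x0 _ (lt_nbhsr hx0)).
  exact: (@coord_continuous R _ _ 0 (@ord_max m) x0 _ (lt_nbhsl x0N)).
(* There are finitely many coordinates, so one neighbourhood serves all horizontal constraints. *)
near: x; apply: filter_forall => i.
have [->|ni] := eqVneq i ord_max; first by near=> x.
have near_i : \forall t \near x0 0 i, `|t| < M + 1.
  have := x0M i ni; rewrite ltr_norml => /andP[lo hi].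
  by near=> t; rewrite ltr_norml; apply/andP; split; near: t;
    [exact: lt_nbhsr | exact: lt_nbhsl].
near=> x => _; apply: ltW; near: x.
exact: (@coord_continuous R _ _ 0 i x0 _ near_i).
Unshelve. all: by end_near. Qed.

Lemma vlip_max_principle (R : realType) (m : nat) (v : 'rV[R]_m.+1 -> R) :
  {within closure halfspace, continuous v} ->
  (forall (x : 'rV[R]_m.+1), x 0 ord_max = 0 -> v x = 0) ->
  (forall eps, 0 < eps -> exists M, vlip eps M v) ->
  (forall a b c x0, halfspace x0 ->
    (\forall x \near x0, v x - vquad a b c x <= v x0 - vquad a b c x0) ->
    0 <= 2 * a) ->
  forall x, closure halfspace x -> v x <= 0.
Proof.
move=> cv bv lv tv x; rewrite {1}closure_halfspace /= => x0.
rewrite leNgt; apply/negP => vx.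
(* This slope gives [k x_n < v x], against the barrier; the [+ 1] keeps the denominator positive on
   the boundary. *)
pose k := v x / (2 * (x 0 ord_max + 1)).
have x1 : 0 < 2 * (x 0 ord_max + 1) by lra.
have k0 : 0 < k by rewrite divr_gt0.
have vk : v x = k * (2 * (x 0 ord_max + 1)) by rewrite divfK// gt_eqF.
have [|M lM] := lv (k / 2); first by rewrite divr_gt0.
have := vlip_barrier cv bv k0 lM tv x0; have := mulr_ge0 (ltW k0) x0; lra.
Qed.

(** * Application to viscosity solutions *)

Theorem theorem1p4 (R : realType) (m : nat) (hn : (2 <= m.+1)%N)
    (alpha : R) (halpha : 0 < alpha) (u : 'rV[R]_m.+1 -> R)
    (hC1 : classC 1 halfspace u)
    (hC : {within closure halfspace, continuous u})
    (hL : viscosity_solution (grushin alpha) halfspace u)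
    (hbd : forall x : 'rV[R]_m.+1, x 0 ord_max = 0 -> u x = 0)
    (hDu : forall eps : R, 0 < eps -> exists M : R,
        forall x : 'rV[R]_m.+1, halfspace x -> M < enorm x ->
          enorm (grad u x) < eps) :
  forall x : 'rV[R]_m.+1, closure halfspace x -> u x = 0.
Proof.
have lu eps : 0 < eps -> exists M, vlip eps M u.
  move=> /hDu[M uM]; exists M; apply: vlip_grad => // x.
  by have [_ /(_ ord_max)[+ _]] := hC1; exact.
case: hL => -[_ subu] [_ supu] x cx; apply/eqP; rewrite eq_le; apply/andP; split.
  apply: vlip_max_principle (cx) => // a b c x0 hx0 near_x0.
  by rewrite -(grushin_vquad alpha a b c x0); apply: subu => //; exact: classC_vquad.
rewrite -oppr_le0; apply: (@vlip_max_principle _ _ (fun x => - u x)) (cx).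
- by move=> y; apply: cvgN; exact: hC.
- by move=> y /hbd ->; rewrite oppr0.
- move=> eps /lu[M uM]; exists M => y t y0 t0 yM.
  by rewrite -opprD normrN; exact: uM.
- move=> a b c x0 hx0 near_x0.
  (* Touching [- u] from above by a [vquad] is touching [u] from below by the [vquad] with opposite
     coefficients, where the supersolution property applies. *)
  suff : 2 * - a <= 0 by lra.
  rewrite -(grushin_vquad alpha (- a) (- b) (- c) x0); apply: supu => //.
    exact: classC_vquad.
  near=> y; have : - u y - vquad a b c y <= - u x0 - vquad a b c x0 by near: y.
  by rewrite /vquad; lra.
Unshelve. all: by end_near. Qed.
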